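(* Let $G$ be a finite complete group, let $g\in G$ be an involution, let $\sigma(g)$ be the inner automorphism $h\mapsto ghg^{-1}$, and let $S\subseteq G$ be a generalized Cayley subset of $G$ induced by $\sigma(g)$. Then for any $x\in N_G(S)=\{y\in G\mid Sy=yS\}$, $$GC(G,S,\sigma(g))\cong GC(G,[g,x]S,\sigma(g)),$$ where $[g,x]=g^{-1}x^{-1}gx$, $[g,x]S=\{[g,x]s\mid s\in S\}$ and $\cong$ denotes graph isomorphism.
   Context: A group $G$ is complete if $Z(G)=\{e\}$ and $\mathrm{Aut}(G)=\mathrm{Inn}(G)$. An involution is an element of order $2$. For $y\in G$ and $\alpha\in\mathrm{Aut}(G)$, $y^\alpha$ denotes the image of $y$ under $\alpha$. Generalized Cayley graphs: given a finite group $G$, an automorphism $\alpha\in\mathrm{Aut}(G)$ and $S\subseteq G$, suppose (a) $\alpha^2=\mathrm{id}$; (b) for every $y\in G$, $(y^{-1})^\alpha y\notin S$; (c) for all $y,h\in G$, if $(h^{-1})^\alpha y\in S$ then $(y^{-1})^\alpha h\in S$. Then $S$ is called a generalized Cayley subset of $G$ induced by $\alpha$, and $GC(G,S,\alpha)$ is the graph with vertex set $G$ and edge set $\{\{y,h\}\mid (y^{-1})^\alpha h\in S\}$. Writing $GC(G,S,\alpha)$ includes the assertion that $S$ is a generalized Cayley subset induced by $\alpha$. *)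

(* Defs.v *)
From HB Require Import structures.
From mathcomp Require Import all_boot all_fingroup all_solvable.

Set Implicit Arguments.
Unset Strict Implicit.
Unset Printing Implicit Defensive.

Import GroupScope.

(* Finite simple graphs whose vertex set is a subset of a finite type. *)
Record sgraph (T : finType) := SGraph {
  vertices : {set T};
  edges : {set {set T}};
  edges_simple :
    forall e, e \in edges -> (e \subset vertices) && (#|e| == 2)
}.

Definition adjacent (T : finType) (X : sgraph T) (u v : T) : bool :=
  [set u; v] \in edges X.

Definition graph_iso (T U : finType) (X : sgraph T) (Y : sgraph U) : Prop :=
  exists f : T -> U,
    [/\ {in vertices X &, injective f},
        f @: vertices X = vertices Y
      & {in vertices X &, forall u v, adjacent X u v = adjacent Y (f u) (f v)}].

Section GeneralizedCayley.

Variable gT : finGroupType.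
Implicit Types (G : {group gT}) (S : {set gT}) (alpha : {perm gT}).

(* An element of Aut G is a permutation of gT that fixes the complement of G
   pointwise.  Conjugation in fingroup is x ^ g = g^-1 * x * g, hence the
   inverse below; see sigmaE. *)
Definition sigma G (g : gT) : {perm gT} := conj_aut G g^-1.

Lemma sigmaE G : {in G &, forall g h, sigma G g h = g * h * g^-1}.
Proof.
by move=> g h Gg Gh; rewrite /sigma conj_autE ?groupV // conjgE invgK mulgA.
Qed.

Definition Inn G : {set {perm gT}} := [set sigma G g | g in G].

Definition complete_group G : Prop := 'Z(G) = 1 /\ Aut G = Inn G.

Record gen_cayley_subset G S alpha : Prop := GenCayleySubset {
  gcs_aut : alpha \in Aut G;
  gcs_sub : S \subset G;
  gcs_invol : alpha * alpha = 1;
  gcs_irr : forall y, y \in G -> alpha (y^-1) * y \notin S;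
  gcs_sym : forall y h, y \in G -> h \in G ->
    alpha (h^-1) * y \in S -> alpha (y^-1) * h \in S
}.

Definition GC_edges G S alpha : {set {set gT}} :=
  [set [set y; h] | y in G, h in G & alpha (y^-1) * h \in S].

Lemma GC_edges_simple G S alpha (gcS : gen_cayley_subset G S alpha) e :
  e \in GC_edges G S alpha -> (e \subset G) && (#|e| == 2).
Proof.
case/imset2P=> y h Gy; rewrite inE => /andP[Gh Syh] ->.
rewrite subUset !sub1set Gy Gh cards2 eqSS eqb1 /=.
by apply/eqP=> eq_yh; case/negP: (gcs_irr gcS Gy); rewrite {2}eq_yh.
Qed.

Definition GC G S alpha (gcS : gen_cayley_subset G S alpha) : sgraph gT :=
  SGraph (GC_edges_simple gcS).

(* By gcs_sym, adjacency does not depend on the orientation of {y, h}. *)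
Lemma GC_adjacentE G S alpha (gcS : gen_cayley_subset G S alpha) :
  {in G &, forall y h, adjacent (GC gcS) y h = (alpha (y^-1) * h \in S)}.
Proof.
move=> y h Gy Gh; rewrite /adjacent /=; apply/imset2P/idP; last first.
  by move=> Syh; exists y h => //; rewrite inE Gh.
case=> a b Ga; rewrite inE => /andP[Gb Sab] eq_yh.
have neq_ab : a != b.
  by apply/eqP=> eq_ab; case/negP: (gcs_irr gcS Ga); rewrite {2}eq_ab.
have [ya yb]: a \in [set y; h] /\ b \in [set y; h].
  by rewrite eq_yh set21 set22.
case/set2P: ya neq_ab Sab => ->; case/set2P: yb => ->; rewrite ?eqxx // => _.
exact: (gcs_sym gcS).
Qed.

(* The library normaliser 'N_G(S), defined by S :^ y \subset S, agrees with
   {y in G | Sy = yS} for an arbitrary subset S. *)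
Lemma normaliserE G S : 'N_G(S) = [set y in G | S :* y == y *: S].
Proof.
apply/setP=> y; rewrite in_setI inE; case: (y \in G) => //=.
apply/normP/eqP => [nSy | eqS]; last by rewrite conjsgE eqS lcosetK.
by rewrite -{2}nSy conjsgE lcosetKV.
Qed.

End GeneralizedCayley.

(* Main.v *)
Require Import Defs.
From mathcomp Require Import all_boot all_fingroup all_solvable.

Import GroupScope.

(** Write [alpha] for conjugation by the involution [g].  Since [S] is invariant
    under conjugation by [x], the element [alpha (y^-1) * h] lies in
    [[~ g, x] *: S] exactly when [alpha ((y * x^-1)^-1) * (h * x^-1)] lies in
    [S].  Hence right translation by [x] carries one graph onto the other, and
    the defining properties of a generalized Cayley subset transfer as well. *)

Lemma mem_lcoset_commg_sigma {gT : finGroupType} {G : {group gT}} {g : gT}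
    {S : {set gT}} {x : gT} :
  g \in G -> #[g] = 2 -> x \in 'N_G(S) ->
  {in G &, forall y h,
    (sigma G g (y^-1) * h \in [~ g, x] *: S)
      = (sigma G g ((y * x^-1)^-1) * (h * x^-1) \in S)}.
Proof.
move=> Gg og /setIP[Gx nSx] y h Gy Gh.
have gV : g^-1 = g by rewrite invg_expg og.
rewrite !sigmaE ?groupV ?groupM ?groupV // mem_lcoset.
(* Conjugating the right-hand element by [x] keeps membership in [S] and cancels its trailing
   [x^-1]. *)
rewrite -[RHS](memJ_norm _ nSx); congr (_ \in S).
(* With [g^-1 = g], the left word is [x^-1 * g * x * g * g * y^-1 * g * h]; its adjacent pair
   [g * g] cancels. *)
by rewrite commgEl !conjgE !invMg !invgK !mulgA mulgKV gV -{3}gV mulgK.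
Qed.

Theorem theorem3p4 (gT : finGroupType) (G : {group gT})
    (hG : complete_group G) (g : gT) (hgG : g \in G) (hg : #[g] = 2)
    (S : {set gT}) (gcS : gen_cayley_subset G S (sigma G g))
    (x : gT) (hx : x \in 'N_G(S)) :
  exists gcS' : gen_cayley_subset G ([~ g, x] *: S) (sigma G g),
    graph_iso (GC gcS) (GC gcS').
Proof.
have Gx : x \in G by case/setIP: hx.
have memS' := mem_lcoset_commg_sigma hgG hg hx.
have GMV z : z \in G -> z * x^-1 \in G by move=> Gz; rewrite groupM ?groupV.
have gcS' : gen_cayley_subset G ([~ g, x] *: S) (sigma G g).
  split.
  - exact: gcs_aut gcS.
  - apply/subsetP=> _ /lcosetP[s Ss ->].
    by rewrite groupM ?groupR // (subsetP (gcs_sub gcS)).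
  - exact: gcs_invol gcS.
  - by move=> y Gy; rewrite memS' // (gcs_irr gcS) ?GMV.
  - by move=> y h Gy Gh; rewrite !memS' // => /(gcs_sym gcS); apply; exact: GMV.
exists gcS', (mulg^~ x); split.
- by move=> y h _ _; exact: mulIg.
- by rewrite -[RHS](rcoset_id Gx) -rcosetE.
(* [memS'] is used at [y * x] and [h * x], so its shifts by [x^-1] undo the translation. *)
- by move=> y h Gy Gh; rewrite !GC_adjacentE ?groupM // memS' ?groupM // !mulgK.
Qed.
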